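(* (a) Let $G$ be a $\kappa$-connected graph of order $n$ and size at least $m$, where $m \leq \binom{n-1}{2}$. Then $\rho(G) \leq \rho(PK_{n,m,\kappa})$. (b) Assume moreover that $m \equiv \binom{n-1}{2} \pmod{\kappa}$ and $\tfrac{1}{2} \big(n(3\kappa-1) - 2\kappa^2 - \kappa+1 - b(\kappa-b)\big) \leq m \leq \binom{n-1}{2}$, where $b$ is the integer in $\{1,2,\ldots,\kappa\}$ with $b \equiv n-1 \pmod{\kappa}$. Then equality $\rho(G) = \rho(PK_{n,m,\kappa})$ holds only if $G= PK_{n,m,\kappa}$.
   Context: All graphs are finite, simple and connected. For a connected graph $G$ of order $n\ge 2$ and a vertex $v$, $\sigma_G(v)=\sum_{w\in V(G)} d_G(v,w)$ and $\overline{\sigma}_G(v)=\sigma_G(v)/(n-1)$; the remoteness is $\rho(G)=\max_{v\in V(G)}\overline{\sigma}_G(v)$. Size means number of edges. For disjoint graphs $G_1,\dots,G_k$, the sequential sum $G_1+\cdots+G_k$ is obtained from their disjoint union by joining every vertex of $G_i$ to every vertex of $G_{i+1}$ for each $i$; $[K_{\kappa}]^{\ell}$ denotes $\ell$ consecutive copies of $K_\kappa$ in such a sum. A graph is $\kappa$-connected if removing fewer than $\kappa$ vertices leaves it connected. A $\kappa$-connected path-complete graph is a graph $K_1 + [K_{\kappa}]^{\ell} + K_a + K_b$ with $\ell,a,b$ positive integers and $a\ge\kappa$. $PK_{n,m,\kappa}$ denotes the $\kappa$-connected path-complete graph of order $n$ and size at least $m$ that has minimum size among all such graphs (it is unique,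 since distinct $\kappa$-connected path-complete graphs of the same order have distinct sizes). *)

(* Defs.v *)
From HB Require Import structures.
From mathcomp Require Import all_boot all_order all_algebra.

Set Implicit Arguments.
Unset Strict Implicit.
Unset Printing Implicit Defensive.

Import Order.TTheory GRing.Theory Num.Theory.

Record sgraph := SGraph {
  vert :> finType;
  adj : rel vert;
  adj_sym : symmetric adj;
  adj_irrefl : irreflexive adj
}.

Definition gorder (G : sgraph) : nat := #|vert G|.

Definition edges (G : sgraph) : {set {set G}} :=
  [set [set p.1; p.2] | p : G * G & adj p.1 p.2].

Definition gsize (G : sgraph) : nat := #|edges G|.

Definition iso (G H : sgraph) : Prop :=
  exists2 f : G -> H, bijective f & forall x y, adj (f x) (f y) = adj x y.

Definition connected (G : sgraph) : Prop :=
  forall x y : G, connect (@adj G) x y.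

Section DeleteVertices.
Variables (G : sgraph) (S : {set G}).

Definition del_vert : finType := {x : G | x \notin S}.
Definition del_adj : rel del_vert := fun u v => adj (val u) (val v).

Lemma del_adj_sym : symmetric del_adj.
Proof. by move=> u v; apply: adj_sym. Qed.

Lemma del_adj_irrefl : irreflexive del_adj.
Proof. by move=> u; apply: adj_irrefl. Qed.

Definition delete : sgraph := SGraph del_adj_sym del_adj_irrefl.
End DeleteVertices.

Definition kconnected (kappa : nat) (G : sgraph) : Prop :=
  forall S : {set G}, #|S| < kappa -> connected (delete S).

Definition walk (G : sgraph) (k : nat) (x y : G) : bool :=
  [exists p : k.-tuple G, path (@adj G) x p && (last x p == y)].

(* A shortest walk has fewer than #|G| edges, so this is the usual distance;
   the value is #|G| when x and y lie in different components. *)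
Definition dist (G : sgraph) (x y : G) : nat :=
  find (fun k => walk k x y) (iota 0 #|G|).

Definition sigma (G : sgraph) (v : G) : nat := \sum_(w : G) dist v w.

Definition avg_sigma (G : sgraph) (v : G) : rat :=
  ((sigma v)%:R / ((gorder G)%:R - 1))%R.

(* All the values avg_sigma v are nonnegative when gorder G >= 2, so the default
   0 does not affect the maximum. *)
Definition remoteness (G : sgraph) : rat :=
  \big[Num.max/0%R]_(v : G) avg_sigma v.

Section Complete.
Variable n : nat.

Definition complete_adj : rel 'I_n := fun i j => i != j.

Lemma complete_adj_sym : symmetric complete_adj.
Proof. by move=> i j; rewrite /complete_adj eq_sym. Qed.

Lemma complete_adj_irrefl : irreflexive complete_adj.
Proof. by move=> i; rewrite /complete_adj eqxx. Qed.

Definition complete : sgraph := SGraph complete_adj_sym complete_adj_irrefl.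
End Complete.

Section SequentialSum.
Variable s : seq sgraph.

Definition summand (i : 'I_(size s)) : sgraph := nth (complete 0) s i.

Definition seqsum_vert : finType := {i : 'I_(size s) & vert (summand i)}.

Definition seqsum_adj : rel seqsum_vert := fun u v =>
  if tag u == tag v then adj (tagged u) (tagged_as u v)
  else ((tag u).+1 == tag v :> nat) || ((tag v).+1 == tag u :> nat).

Lemma seqsum_adj_sym : symmetric seqsum_adj.
Proof.
move=> [i x] [j y]; rewrite /seqsum_adj /= [j == i]eq_sym.
case: (eqVneq i j) => [eq_ij | _]; last by rewrite orbC.
by case: j / eq_ij y => y; rewrite !tagged_asE adj_sym.
Qed.

Lemma seqsum_adj_irrefl : irreflexive seqsum_adj.
Proof. by move=> [i x]; rewrite /seqsum_adj /= eqxx tagged_asE adj_irrefl. Qed.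

Definition seqsum : sgraph := SGraph seqsum_adj_sym seqsum_adj_irrefl.
End SequentialSum.

Definition path_complete (kappa l a b : nat) : sgraph :=
  seqsum (complete 1 :: nseq l (complete kappa) ++ [:: complete a; complete b]).

Definition is_path_complete (kappa : nat) (G : sgraph) : Prop :=
  exists l a b : nat,
    [/\ 0 < l, 0 < a, 0 < b, kappa <= a & iso G (path_complete kappa l a b)].

(* P is (a copy of) the graph PK_{n,m,kappa}. *)
Definition is_PK (n m kappa : nat) (P : sgraph) : Prop :=
  [/\ is_path_complete kappa P, gorder P = n, m <= gsize P
    & forall Q : sgraph, is_path_complete kappa Q -> gorder Q = n ->
        m <= gsize Q -> gsize P <= gsize Q].

(* Main.v *)
Require Import Defs.
From HB Require Import structures.
From mathcomp Require Import all_boot all_order all_algebra.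
From mathcomp Require Import zify lra.

Set Implicit Arguments.
Unset Strict Implicit.
Unset Printing Implicit Defensive.

Import Order.TTheory GRing.Theory Num.Theory.

(**
Let f be the distance from a vertex v of a kappa-connected graph G of order n.
The layers f = 1, ..., d - 1 all have at least kappa vertices, so a vertex w with
f w >= 2 has at least 1 + kappa (f w - 2) vertices u with f u <= f w - 2, none of
them adjacent to w. Summing kappa * f w - #{u | f u <= f w - 2} over w gives
  kappa * sigma v + size G <= 'C(n, 2) + (n - 1)(2 kappa - 1) - kappa (kappa - 1),
and path-complete graphs, with v the vertex of the initial K_1, attain equality.
Along the path-complete graphs of order n the size thus moves in steps of kappa
while sigma moves in steps of 1, so PK_{n,m,kappa} has size less than m + kappa,
unless it is the smallest path-complete graph, in which case all its sets f > j are
as large as connectivity allows. In the equality case the sizes of the sets f > j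
are those of a path-complete graph, and these are determined by their sum.
*)

(** * Level sets of an integer-valued function and the weight inequality *)

Section Profile.
Variables (T : finType) (f : T -> nat).

Definition level i := #|[pred x | f x == i]|.
Definition tail i := #|[pred x | i < f x]|.
(** The pairs are ordered by [f], so every unordered pair at levels two or more apart occurs once.
    When [f] is a distance function these pairs are non-edges. *)
Definition far := [set p : T * T | (f p.1).+1 < f p.2].

Lemma tail_recl i : tail i = level i.+1 + tail i.+1.
Proof.
rewrite /tail -(cardID [pred x | f x == i.+1]); congr (_ + _).
  by apply: eq_card => x; rewrite !inE; lia.
by apply: eq_card => x; rewrite !inE; lia.
Qed.

Lemma card_level_tail : #|T| = level 0 + tail 0.
Proof.
rewrite -(cardC [pred x | f x == 0]); congr (_ + _).
by apply: eq_card => x; rewrite !inE; lia.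
Qed.

(** Each [x] is counted in exactly the tails [j < f x]. *)
Lemma sum_tail B : (forall x, f x <= B) -> \sum_x f x = \sum_(j < B) tail j.
Proof.
move=> fB; under [RHS]eq_bigr => j _ do rewrite /tail -sum1_card big_mkcond /=.
rewrite exchange_big /=; apply: eq_bigr => x _.
rewrite -big_mkcond /=.
by rewrite (big_ord_narrow (fB x)) /= sum1_card card_ord.
Qed.

Lemma card_far : #|far| = \sum_w #|[pred u | (f u).+1 < f w]|.
Proof.
rewrite -sum1_card (eq_bigl (fun p => true && ((f p.1).+1 < f p.2))); last first.
  by move=> p; rewrite inE.
rewrite -(pair_big_dep xpredT (fun u w => (f u).+1 < f w) (fun _ _ => 1)) /=.
rewrite (exchange_big_dep xpredT) //=; apply: eq_bigr => w _.
by rewrite sum1_card.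
Qed.

Lemma below_tail j : #|[pred u | (f u).+1 < j.+2]| + tail j = #|T|.
Proof.
rewrite -(cardC [pred u | (f u).+1 < j.+2]); congr (_ + _).
by apply: eq_card => x; rewrite !inE; lia.
Qed.

Lemma tail_anti i j : i <= j -> tail j <= tail i.
Proof.
by move=> ij; apply: subset_leq_card; apply/subsetP => x; rewrite !inE; apply: leq_ltn_trans.
Qed.

Lemma tail_gt0 j : reflect (exists x, j < f x) (0 < tail j).
Proof. exact: card_gt0P. Qed.

Lemma level_gt0 j : reflect (exists x, f x = j) (0 < level j).
Proof.
by apply: (iffP (card_gt0P)) => -[x]; [rewrite inE => /eqP|move/eqP]; exists x.
Qed.

Section Weight.
Variable k : nat.

(** With kappa written [k.+1], this is kappa * [f w], corrected at levels 0 and 1 so that [cost_le]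
    holds there with equality. *)
Definition cost w :=
  k.+1 * f w + (f w == 1) * k + (f w == 0) * k.*2.+1.

Lemma sum_cost : \sum_w cost w =
  k.+1 * (\sum_w f w) + level 1 * k + level 0 * k.*2.+1.
Proof.
have indic i c : \sum_w (f w == i) * c = level i * c.
  rewrite -big_distrl /= /level -sum1_card; congr (_ * _); rewrite [RHS]big_mkcond /=.
  by apply: eq_bigr => w _; rewrite inE; case: eqP.
by rewrite !big_split /= -big_distrr /= !indic.
Qed.

Hypotheses (level0 : level 0 = 1)
  (level_ge : forall i, 0 < i -> 0 < tail i -> k < level i).

(** As long as the tail is nonempty, each further level takes away more than [k] elements; once it
    is empty, the truncated bound is trivial. *)
Lemma tail_le j : tail j <= #|T| - 1 - k.+1 * j.
Proof.
elim: j => [|j IH]; first by rewrite card_level_tail level0; lia.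
have [->//|/(level_ge (ltn0Sn j))] := posnP (tail j.+1).
by move: IH; rewrite tail_recl mulnS; lia.
Qed.

(** Equality in [tail_le], except possibly at the last nonzero tail and after it. *)
Definition tight := forall j, 0 < tail j.+1 -> tail j = #|T| - 1 - k.+1 * j.

(** At level [j.+2] the elements counted on the right form the complement of the tail at [j], so
    this is [tail_le] at [j]. *)
Lemma cost_le w :
  cost w <= #|[pred u | (f u).+1 < f w]| + k.*2.+1 ?= iff
    ((f w < 2) || (tail (f w).-2 == #|T| - 1 - k.+1 * (f w).-2)).
Proof.
rewrite /cost; case fw: (f w) => [|[|j]] /=.
- by rewrite muln0 !add0n mul1n eq_card0 //; apply/leqif_refl.
- by rewrite eq_card0 //; split; lia.
(* A nonempty tail excludes truncation in the bound of [tail_le]. *)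
have t_gt0 : 0 < tail j by apply/tail_gt0; exists w; rewrite fw; lia.
have := tail_le j; have := below_tail j; rewrite /= !mulnS !mul0n.
move: #|_| (tail j) t_gt0 => c t t_gt0.
by split; lia.
Qed.

(** If nothing lies beyond level 1, that level contains all elements but one. *)
Lemma level1_gt : k.+1 < #|T| -> k < level 1.
Proof.
have [t1|/(@level_ge 1 isT) //] := posnP (tail 1).
by rewrite card_level_tail level0 tail_recl t1; lia.
Qed.

Lemma sum_below : \sum_w (#|[pred u | (f u).+1 < f w]| + k.*2.+1) =
  #|far| + #|T| * k.*2.+1.
Proof. by rewrite big_split /= -card_far sum_nat_const. Qed.

Lemma weight_le : k.+1 < #|T| ->
  k.+1 * (\sum_w f w) + k.+1 * k <= #|far| + (#|T| - 1) * k.*2.+1.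
Proof.
move=> nk.
have : \sum_w cost w <= \sum_w (#|[pred u | (f u).+1 < f w]| + k.*2.+1).
  by apply: leq_sum => w _; apply: cost_le.
rewrite sum_cost sum_below level0 => le1.
have : k.+1 * k <= level 1 * k by rewrite leq_mul ?level1_gt.
by rewrite mulnBl; lia.
Qed.

(** Equality of the sums forces equality in [cost_le] at every [w]; for [w] at level [j.+2] this is
    tightness at [j]. *)
Lemma weight_eq_tight : k.+1 < #|T| ->
  k.+1 * (\sum_w f w) + k.+1 * k = #|far| + (#|T| - 1) * k.*2.+1 -> tight.
Proof.
move=> nk weq; have le0 := leqif_sum (fun w (_ : true) => cost_le w).
have kk_le : k.+1 * k <= level 1 * k by rewrite leq_mul ?level1_gt.
have /eqP : \sum_w cost w = \sum_w (#|[pred u | (f u).+1 < f w]| + k.*2.+1).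
  apply/eqP; rewrite eqn_leq le0 /= sum_cost sum_below.
  by rewrite level0; move: weq; rewrite mulnBl; lia.
rewrite (eq_leqif le0) => /forallP tw j t_gt0.
(* No level is skipped: if anything lies at or beyond level [j.+2], some element lies exactly
   there. *)
have /level_gt0[w fw] : 0 < level j.+2.
  have [t0|/(level_ge (ltn0Sn _))] := posnP (tail j.+2); last by lia.
  by move: t_gt0; rewrite tail_recl t0; lia.
by have := tw w; rewrite fw /= => /eqP.
Qed.

Lemma tight_weight_eq : level 1 = k.+1 -> tight ->
  k.+1 * (\sum_w f w) + k.+1 * k = #|far| + (#|T| - 1) * k.*2.+1.
Proof.
move=> level1 tf; have : \sum_w cost w =
    \sum_w (#|[pred u | (f u).+1 < f w]| + k.*2.+1).
  apply: eq_bigr => w _; apply/eqP; rewrite (eq_leqif (cost_le w)).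
  case fw: (f w) => [|[|j]] //=; apply/eqP/tf/tail_gt0.
  by exists w; rewrite fw.
rewrite sum_cost sum_below level0 level1 mulnBl.
have : k.*2.+1 <= #|T| * k.*2.+1.
  by rewrite leq_pmull // card_level_tail level0.
by lia.
Qed.
End Weight.
End Profile.

(** * Tight profiles with equal sums *)

Section TwoProfiles.
Variables (T T' : finType) (f : T -> nat) (g : T' -> nat) (k : nat).
Hypotheses (eq_card : #|T| = #|T'|) (sum_eq : \sum_x f x = \sum_y g y).

(* Two tight tails are comparable: if each is strictly smaller than the other
   somewhere, then the one smaller at the earlier index is nonzero later on, hence
   maximal at that index. *)
Lemma tight_tail_le : (forall j, tail g j <= #|T| - 1 - k.+1 * j) ->
  (forall j, tail f j <= #|T| - 1 - k.+1 * j) ->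
  tight f k -> tight g k -> forall j, tail f j <= tail g j.
Proof.
move=> g_le f_le tf tg j; rewrite leqNgt; apply/negP => lt_j.
have le_i i : tail g i <= tail f i.
  rewrite leqNgt; apply/negP => lt_i; case: (ltngtP i j) => [ij|ji|ij].
  - have := tail_anti f ij; have := tf i; have := g_le i; lia.
  - have := tail_anti g ji; have := tg j; have := f_le j; rewrite -eq_card; lia.
  - by move: lt_i lt_j; rewrite ij; lia.
pose B := maxn j.+1 (maxn (\max_x f x) (\max_y g y)).
have fB x : f x <= B by rewrite 2!leq_max; apply/orP; right; rewrite leq_bigmax.
have gB y : g y <= B by rewrite 2!leq_max leq_bigmax !orbT.
have jB : j < B by rewrite leq_max leqnn.
have /eqP := sum_eq; rewrite (sum_tail fB) (sum_tail gB) gtn_eqF //.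
rewrite (bigD1 (Ordinal jB)) //= [in ltnRHS](bigD1 (Ordinal jB)) //=.
by rewrite -addSn leq_add // leq_sum.
Qed.
End TwoProfiles.

(** * Edges against far pairs in a graph with a level function *)

Lemma set2_eq (T : finType) (x y u v : T) : [set x; y] = [set u; v] ->
  (x = u /\ y = v) \/ (x = v /\ y = u).
Proof.
move/setP => E; have := (E x, E y, E u, E v); rewrite !inE !eqxx /= !orbT.
move=> [[[/esym ex /esym ey] eu] ev].
case/orP: ex => /eqP ex; [left|right]; split=> //; subst x.
  by case/orP: ev ey => /eqP <- // /orP[] /eqP.
by case/orP: eu ey => /eqP <- // /orP[] /eqP.
Qed.

Section Layers.
Variables (G : sgraph) (f : G -> nat).

Definition lipschitz := forall x y : G, adj x y -> f y <= (f x).+1.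
(** These graphs are the sequential sums of complete graphs on the levels of [f]. *)
Definition layered := forall x y : G,
  adj x y = [&& x != y, f x <= (f y).+1 & f y <= (f x).+1].

Let far_sets := [set [set p.1; p.2] | p in far f].
Let pairs := [set A : {set G} | #|A| == 2].

Lemma in_edges (x y : G) : ([set x; y] \in edges G) = adj x y.
Proof.
apply/imsetP/idP => [[[u v]]|xy]; last by exists (x, y); rewrite ?inE.
by rewrite inE /= => uv /set2_eq[[-> ->]|[-> ->]] //; rewrite adj_sym.
Qed.

Lemma layered_lipschitz : layered -> lipschitz.
Proof. by move=> lf x y; rewrite lf => /and3P[]. Qed.

Lemma card_far_sets : #|far_sets| = #|far f|.
Proof.
rewrite card_in_imset // => -[x y] [u v]; rewrite !inE /= => fxy fuv.
by case/set2_eq => [[-> ->]|[xv yu]] //; move: fxy fuv; rewrite xv yu; lia.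
Qed.

Lemma in_far_sets (x y : G) : ([set x; y] \in far_sets) =
  ((f x).+1 < f y) || ((f y).+1 < f x).
Proof.
apply/imsetP/orP => [[[u v]]|[xy|xy]].
- by rewrite inE /= => uv /set2_eq[[-> ->]|[-> ->]]; [left|right].
- by exists (x, y); rewrite // inE.
- by exists (y, x); rewrite ?inE //= setUC.
Qed.

Lemma edges_far_disjoint : lipschitz -> [disjoint edges G & far_sets].
Proof.
move=> lf; rewrite -setI_eq0; apply/eqP/setP => A; rewrite !inE.
apply/negP => /andP[/imsetP[[x y]]]; rewrite inE /= => xy ->.
rewrite in_far_sets; have := lf _ _ xy; move: xy; rewrite adj_sym.
by move/lf; lia.
Qed.

Lemma edges_far_pairs : edges G :|: far_sets \subset pairs.
Proof.
apply/subsetP => A; rewrite !inE => /orP[] /imsetP[[x y]]; rewrite inE /= => xy ->.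
  by rewrite cards2; have [eq_xy|//] := eqVneq x y; rewrite eq_xy adj_irrefl in xy.
by rewrite cards2; have [eq_xy|//] := eqVneq x y; rewrite eq_xy in xy; lia.
Qed.

Lemma gsize_far : lipschitz -> gsize G + #|far f| = #|edges G :|: far_sets|.
Proof.
move=> lf; rewrite -card_far_sets /gsize -cardsUI; apply/eqP.
by rewrite (eqP (_ : _ :&: _ == set0)) ?cards0 ?addn0 // setI_eq0 edges_far_disjoint.
Qed.

Lemma gsize_far_le : lipschitz -> gsize G + #|far f| <= 'C(gorder G, 2).
Proof.
move=> lf; rewrite gsize_far // -(card_draws G 2).
exact: subset_leq_card edges_far_pairs.
Qed.

Lemma gsize_far_eq : layered -> gsize G + #|far f| = 'C(gorder G, 2).
Proof.
move=> lf; rewrite gsize_far; last exact: layered_lipschitz.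
rewrite -(card_draws G 2); apply: eq_card => A; apply/idP/idP.
  exact: (subsetP edges_far_pairs).
rewrite inE => /cards2P[x [y [xy ->]]]; rewrite inE in_edges in_far_sets lf xy /=.
lia.
Qed.

(** With equality, edges and far pairs exhaust all 2-subsets, so every pair that is not far is an
    edge. *)
Lemma gsize_far_layered : lipschitz ->
  gsize G + #|far f| = 'C(gorder G, 2) -> layered.
Proof.
move=> lf; rewrite gsize_far // -(card_draws G 2) => /eqP eqc.
have /setP eqp : edges G :|: far_sets = pairs.
  by apply/eqP; rewrite eqEcard edges_far_pairs (eqP eqc) leqnn.
move=> x y; have [<-|xy] := eqVneq x y; first by rewrite adj_irrefl.
have := eqp [set x; y]; rewrite !inE in_edges in_far_sets cards2 xy eqxx /=.
case axy: (adj x y) => /=; last by lia.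
by rewrite (lf _ _ axy) lf // adj_sym.
Qed.

(** Level [i] separates [v] from the vertices beyond it, because [f] grows by at most one along an
    edge and a path cannot jump over the level. *)
Lemma kconnected_level kappa v i : kconnected kappa G -> lipschitz -> f v = 0 ->
  0 < i -> 0 < tail f i -> kappa <= level f i.
Proof.
move=> Gk lf fv i_gt0 /tail_gt0[w fw]; rewrite leqNgt; apply/negP => lt_k.
pose S := [set x | f x == i].
have S_lt : #|S| < kappa by rewrite cardsE.
have vS : v \notin S by rewrite inE fv; lia.
have wS : w \notin S by rewrite inE; lia.
have /connectP[p pth lst] := Gk S S_lt (Sub v vS) (Sub w wS).
pose g (u : delete S) := f (val u).
have : g (Sub v vS) < i by rewrite /g SubK fv.
have : i < g (last (Sub v vS) p) by rewrite /g -lst SubK.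
elim: p (Sub v vS) pth {lst} => [|z p IH] x /=; first by lia.
case/andP => xz pth last_gt x_lt; apply: (IH z) => //.
have : g z <= (g x).+1 by apply: lf xz.
have : g z != i by have := valP z; rewrite inE.
by lia.
Qed.

End Layers.

(** * Walks and distance *)

Section Distance.
Variable G : sgraph.

Lemma walkP n (x y : G) : reflect
  (exists p : seq G, [/\ size p = n, path (@adj G) x p & last x p = y]) (walk n x y).
Proof.
apply: (iffP existsP) => [[p /andP[pth /eqP lst]]|[p [sz pth lst]]].
  by exists p; rewrite size_tuple.
by exists (tcast sz (in_tuple p)); rewrite val_tcast pth lst eqxx.
Qed.

Lemma dist_le_order (x y : G) : dist x y <= gorder G.
Proof. by rewrite -[gorder G](size_iota 0) find_size. Qed.

Lemma dist_walk (x y : G) : dist x y < gorder G -> walk (dist x y) x y.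
Proof.
move=> lt_d; have := lt_d; rewrite /gorder -(size_iota 0 #|G|) -has_find.
by move/(nth_find 0); rewrite nth_iota.
Qed.

Lemma walk_dist n (x y : G) : walk n x y -> dist x y <= n.
Proof.
move=> wn; have [lt_n|] := ltnP n #|G|; last exact: leq_trans (dist_le_order x y).
rewrite leqNgt; apply/negP => /(before_find 0).
by rewrite nth_iota // wn.
Qed.

Lemma dist_lipschitz (v : G) : lipschitz (dist v).
Proof.
move=> x y xy; have [/dist_walk/walkP[p [sz pth lst]]|] := ltnP (dist v x) (gorder G).
  apply: walk_dist; apply/walkP; exists (rcons p y).
  by rewrite size_rcons sz rcons_path pth lst last_rcons.
by move=> le_d; apply: leq_trans (dist_le_order v y) _; lia.
Qed.

Lemma dist_eq0 (v x : G) : (dist v x == 0) = (x == v).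
Proof.
have n_gt0 : 0 < gorder G by apply/card_gt0P; exists v.
apply/eqP/eqP => [d0|->]; last first.
  by apply/eqP; rewrite -leqn0 walk_dist //; apply/walkP; exists [::].
have /dist_walk/walkP[p [sz _ <-]] : dist v x < gorder G by rewrite d0.
by move: sz; rewrite d0 => /size0nil ->.
Qed.

Lemma level0_dist (v : G) : level (dist v) 0 = 1.
Proof. by rewrite -(card1 v); apply: eq_card => x; rewrite !inE dist_eq0. Qed.

(** Along a walk [f] grows by at most one per step. The bound by the order covers the default value
    of [dist]. *)
Lemma lipschitz_dist (f : G -> nat) v x : lipschitz f -> f v = 0 ->
  f x <= gorder G -> f x <= dist v x.
Proof.
move=> lf fv fx; have [/dist_walk/walkP[p [<- pth <-]]|] := ltnP (dist v x) (gorder G).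
  suff: f (last v p) <= f v + size p by rewrite fv.
  elim: p v pth {fv} => [|z p IH] v /=; first by rewrite addn0.
  by case/andP => /lf vz /IH; lia.
exact: leq_trans.
Qed.

End Distance.

(** * Isomorphism of layered graphs with equal level sizes *)

Lemma eq_level_bij (T T' : finType) (f : T -> nat) (g : T' -> nat) :
  (forall i, level f i = level g i) ->
  exists2 h : T -> T', bijective h & forall x, g (h x) = f x.
Proof.
move=> eq_l.
have inF x : x \in enum [pred y | f y == f x] by rewrite mem_enum inE.
have idx_lt x : index x (enum [pred y | f y == f x]) < level g (f x).
  by rewrite -eq_l /level cardE index_mem.
have ex_y x : exists y : T', y \in enum [pred y | g y == f x].
  have : 0 < level g (f x) by apply: leq_ltn_trans (idx_lt x).
  by case/card_gt0P => y; rewrite -mem_enum; exists y.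
(* The i-th element of a level of [f] goes to the i-th element of the same level of [g]; the chosen
   element is only a default for [nth]. *)
pose h x := nth (xchoose (ex_y x)) (enum [pred y | g y == f x])
                (index x (enum [pred y | f y == f x])).
have gh x : g (h x) = f x.
  have : h x \in enum [pred y | g y == f x] by rewrite mem_nth // -cardE.
  by rewrite mem_enum inE => /eqP.
have inj_h : injective h.
  move=> x y eq_h; have eq_f : f x = f y by rewrite -!gh eq_h.
  have := eq_h; rewrite /h.
  rewrite [nth (xchoose (ex_y x)) _ _](set_nth_default (xchoose (ex_y y))); last first.
    by rewrite -cardE.
  rewrite eq_f => /eqP; rewrite nth_uniq ?enum_uniq -?cardE //; last first.
    by have := idx_lt x; rewrite eq_f.
  by move/eqP/(congr1 (nth x (enum [pred z | f z == f y]))); rewrite !nth_index // -eq_f.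
exists h => //; apply: inj_card_bij => //.
have sum_level (S : finType) (u : S -> nat) B : (forall x, u x < B) ->
    #|S| = \sum_(i < B) level u i.
  move=> uB; rewrite -sum1_card (partition_big (fun x => Ordinal (uB x)) xpredT) //=.
  apply: eq_bigr => i _; rewrite /level -sum1_card; apply: eq_bigl => x.
  by rewrite !inE -val_eqE.
pose B := (maxn (\max_x f x) (\max_y g y)).+1.
have fB x : f x < B by rewrite ltnS leq_max leq_bigmax.
have gB y : g y < B by rewrite ltnS leq_max leq_bigmax orbT.
by rewrite (sum_level _ _ _ fB) (sum_level _ _ _ gB) leq_sum // => i _; rewrite eq_l.
Qed.

Lemma layered_iso (G H : sgraph) (f : G -> nat) (g : H -> nat) :
  layered f -> layered g -> (forall i, level f i = level g i) -> iso G H.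
Proof.
move=> lf lg /eq_level_bij[h bij_h gh]; exists h => // x y.
by rewrite lf lg !gh (inj_eq (bij_inj bij_h)).
Qed.

(** * Sequential sums and path-complete graphs as layered graphs *)

Section SequentialSumLayers.
Variable s : seq sgraph.

Let layer (u : seqsum s) : nat := tag u.

Lemma seqsum_level i : level layer i = gorder (nth (complete 0) s i).
Proof.
have [lt_i|le_i] := ltnP i (size s); last first.
  rewrite nth_default // /gorder card_ord; apply: eq_card0 => u.
  by rewrite !inE /layer; have := ltn_ord (tag u); lia.
pose i0 := Ordinal lt_i; rewrite -/(gorder (summand i0)) /gorder.
have inj : injective (@Tagged _ i0 (fun i => vert (summand i))).
  by move=> x y /eqP; rewrite -tag_eqE /tag_eq /= eqxx tagged_asE => /eqP.
rewrite -(card_codom inj); apply: eq_card => u; rewrite inE.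
apply/eqP/codomP => [|[x -> //]]; case: u => j x; rewrite /layer /= => ij.
have e : j = i0 by apply: val_inj.
by move: x; rewrite e => x; exists x.
Qed.

Lemma seqsum_layered :
  (forall (i : 'I_(size s)) (x y : summand i), adj x y = (x != y)) ->
  layered layer.
Proof.
move=> compl [i x] [j y]; rewrite /layer /adj /= /seqsum_adj /=.
have [eq_ij|ne_ij] := eqVneq i j.
  case: j / eq_ij y => y; rewrite tagged_asE compl leqnSn !andbT.
  by rewrite -tag_eqE /tag_eq /= eqxx tagged_asE.
rewrite -tag_eqE /tag_eq /= (negPf ne_ij) /=.
by move: ne_ij; rewrite -val_eqE /=; lia.
Qed.
End SequentialSumLayers.

Definition pc_level kappa l a b i := nth 0 (1 :: nseq l kappa ++ [:: a; b]) i.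

Lemma path_complete_layers kappa l a b (Q : sgraph) :
  iso Q (path_complete kappa l a b) ->
  exists2 g : Q -> nat, layered g & forall i, level g i = pc_level kappa l a b i.
Proof.
case=> h bij_h adj_h; pose ks := 1 :: nseq l kappa ++ [:: a; b].
have def_s : complete 1 :: nseq l (complete kappa) ++ [:: complete a; complete b] =
    map complete ks by rewrite /= map_cat map_nseq.
rewrite /path_complete def_s in h bij_h adj_h *.
exists (fun x => nat_of_ord (tag (h x))) => [x y|i].
  rewrite -adj_h seqsum_layered ?(inj_eq (bij_inj bij_h)) // => i.
  (* Abstracting over the graph lets [summand i] be rewritten to a complete graph although the
     vertex types depend on it. *)
  pose P (G : sgraph) := forall x y : G, adj x y = (x != y).
  suff: P (summand i) by [].
  by rewrite /summand (nth_map 0) // -(size_map complete).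
rewrite -[RHS]/(nth 0 ks i).
transitivity (gorder (nth (complete 0) (map complete ks) i)).
  rewrite -seqsum_level /level -(card_image (bij_inj bij_h)).
  apply: eq_card => u; apply/imageP/idP => [[x Px ->]//|Pu].
  by case: bij_h => h' hK h'K; exists (h' u); rewrite ?inE h'K.
have [lt_i|le_i] := ltnP i (size ks); last first.
  by rewrite !nth_default ?size_map // /gorder card_ord.
by rewrite (nth_map 0) // /gorder card_ord.
Qed.

(** * The profile of a path-complete graph *)

Section PathCompleteProfile.
Variables (T : finType) (g : T -> nat) (k l a b : nat).
Hypotheses (l_gt0 : 0 < l) (b_gt0 : 0 < b) (a_gt : k < a)
  (g_level : forall i, level g i = pc_level k.+1 l a b i).

Lemma pc_level0 : level g 0 = 1. Proof. by rewrite g_level. Qed.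

Lemma pc_level_mid i : 0 < i <= l -> level g i = k.+1.
Proof.
case: i => // i /andP[_ il]; rewrite g_level /pc_level /= nth_cat size_nseq il.
by rewrite nth_nseq il.
Qed.

Lemma pc_level_a : level g l.+1 = a.
Proof. by rewrite g_level /pc_level /= nth_cat size_nseq ltnn subnn. Qed.

Lemma pc_level_b : level g l.+2 = b.
Proof. by rewrite g_level /pc_level /= nth_cat size_nseq ltnNge leqnSn subSnn. Qed.

Lemma pc_le x : g x <= l.+2.
Proof.
rewrite leqNgt; apply/negP => gx; have : 0 < level g (g x) by apply/level_gt0; exists x.
rewrite g_level /pc_level nth_default //= size_cat size_nseq /=; lia.
Qed.

Lemma pc_tail_big j : l.+1 < j -> tail g j = 0.
Proof.
move=> lj; apply/eqP; rewrite -leqn0 leqNgt; apply/tail_gt0 => -[x].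
by have := pc_le x; lia.
Qed.

Lemma pc_tail_b : tail g l.+1 = b.
Proof. by rewrite tail_recl pc_level_b pc_tail_big ?addn0. Qed.

Lemma pc_tail_mid i : i <= l -> tail g (l - i) = k.+1 * i + a + b.
Proof.
elim: i => [|i IH] il.
  by rewrite subn0 tail_recl pc_tail_b pc_level_a muln0.
have e : (l - i.+1).+1 = l - i by lia.
by rewrite tail_recl e IH ?pc_level_mid ?mulnS; lia.
Qed.

Lemma pc_card : #|T| = 1 + k.+1 * l + a + b.
Proof.
have := pc_tail_mid (leqnn l); rewrite subnn (card_level_tail g) pc_level0; lia.
Qed.

Lemma pc_tail j : j <= l -> tail g j = #|T| - 1 - k.+1 * j.
Proof.
move=> jl; have := pc_tail_mid (leq_subr j l); rewrite subKn // pc_card => ->.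
have : k.+1 * l = k.+1 * (l - j) + k.+1 * j by rewrite -mulnDr subnK.
by move: (k.+1 * l) (k.+1 * (l - j)) (k.+1 * j); lia.
Qed.

Lemma pc_level_ge i : 0 < i -> 0 < tail g i -> k < level g i.
Proof.
move=> i_gt0 t_gt0; have [il|] := leqP i l; first by rewrite pc_level_mid ?i_gt0.
rewrite leq_eqVlt => /orP[/eqP <-|/pc_tail_big t0]; first by rewrite pc_level_a.
by rewrite t0 in t_gt0.
Qed.

Lemma pc_tight : tight g k.
Proof.
move=> j t_gt0; apply: pc_tail; rewrite leqNgt; apply/negP => lj.
by rewrite pc_tail_big in t_gt0.
Qed.

Lemma pc_sum : \sum_x g x = \sum_(j < l.+1) (#|T| - 1 - k.+1 * j) + b.
Proof.
rewrite (sum_tail pc_le) big_ord_recr /= pc_tail_b; congr (_ + _).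
by apply: eq_bigr => j _; apply: pc_tail; rewrite -ltnS.
Qed.

Lemma pc_weight :
  k.+1 * (\sum_w g w) + k.+1 * k = #|far g| + (#|T| - 1) * k.*2.+1.
Proof.
apply: (tight_weight_eq pc_level0 pc_level_ge _ pc_tight).
by rewrite pc_level_mid.
Qed.

(* When a = kappa and b <= kappa, every tail is as large as kappa-connectivity allows. *)
Lemma pc_tail_max j : a = k.+1 -> b <= k.+1 -> tail g j = #|T| - 1 - k.+1 * j.
Proof.
move=> ak bk; have [|lj] := leqP j l; first exact: pc_tail.
have : k.+1 * l.+1 <= k.+1 * j by rewrite leq_mul.
rewrite mulnS pc_card; case: (ltngtP j l.+1) lj => // [lj|->] _ le_j.
  have : k.+1 * l.+2 <= k.+1 * j by rewrite leq_mul.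
  by rewrite pc_tail_big // !mulnS; lia.
by rewrite pc_tail_b mulnS; lia.
Qed.

End PathCompleteProfile.

(** * Sizes of path-complete graphs and of PK *)

Lemma iso_refl (G : sgraph) : iso G G.
Proof. by exists id => //; exists id. Qed.

(** The weight equality with far pairs replaced by non-edges and the sum of levels by its closed
    form: for a given order, the size depends only on that sum. *)
Lemma gsize_path_complete k l a b (Q : sgraph) :
  0 < l -> 0 < b -> k < a -> iso Q (path_complete k.+1 l a b) ->
  gorder Q = 1 + k.+1 * l + a + b /\
  gsize Q + k.+1 * (\sum_(j < l.+1) (gorder Q - 1 - k.+1 * j) + b) + k.+1 * k =
    'C(gorder Q, 2) + (gorder Q - 1) * k.*2.+1.
Proof.
move=> l_gt0 b_gt0 ka /path_complete_layers[g lg g_level].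
have := pc_weight l_gt0 b_gt0 ka g_level; have := gsize_far_eq lg.
have := pc_sum l_gt0 b_gt0 ka g_level.
have := pc_card l_gt0 b_gt0 ka g_level.
by rewrite -/(gorder Q) => card_Q -> ? ?; split=> //; lia.
Qed.

(** Doubled to avoid division; the hypothesis excludes truncated subtraction. *)
Lemma sum_arith_prog c N l : c * l <= N ->
  2 * (\sum_(j < l.+1) (N - c * j)) + c * l * l.+1 = 2 * l.+1 * N.
Proof.
elim: l => [|l IH] le_N; first by rewrite big_ord1 !muln0; lia.
have le_N' : c * l <= N by apply: leq_trans le_N; rewrite leq_mul.
rewrite big_ord_recr /= mulnDr; have := IH le_N'.
move: (\sum_(_ < _) _) => S E.
have : 2 * (N - c * l.+1) + 2 * (c * l.+1) = 2 * N by rewrite -mulnDr subnK.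
nia.
Qed.

(** Outside the second alternative there is a path-complete graph of the same order with exactly
    kappa fewer edges, and minimality of [P] puts its size below [m]. *)
Lemma PK_size_dichotomy n m k l a b (P : sgraph) :
  is_PK n m k.+1 P -> 0 < l -> 0 < b -> k < a ->
  iso P (path_complete k.+1 l a b) ->
  gsize P < m + k.+1 \/ a = k.+1 /\ b <= k.+1.
Proof.
move=> [_ order_P _ min_P] l_gt0 b_gt0 ka isoP.
have [card_P size_P] := gsize_path_complete l_gt0 b_gt0 ka isoP.
(* By [gsize_path_complete], raising the sum by one lowers the size by kappa. *)
have step l' a' b' : 0 < l' -> 0 < b' -> k < a' ->
    k.+1 * l' + a' + b' = k.+1 * l + a + b ->
    \sum_(j < l'.+1) (gorder P - 1 - k.+1 * j) + b' =
    (\sum_(j < l.+1) (gorder P - 1 - k.+1 * j) + b).+1 ->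
    gsize P < m + k.+1.
  move=> l'_gt0 b'_gt0 ka' eq_n eq_s.
  pose Q := path_complete k.+1 l' a' b'.
  have [card_Q size_Q] := gsize_path_complete l'_gt0 b'_gt0 ka' (iso_refl Q).
  have order_Q : gorder Q = gorder P by rewrite card_Q card_P; lia.
  move: size_Q; rewrite order_Q eq_s mulnS => size_Q.
  rewrite ltnNge; apply/negP => le_m.
  have /min_P : is_path_complete k.+1 Q.
    exists l', a', b'; split=> //; [exact: leq_ltn_trans ka'|exact: iso_refl].
  by rewrite order_Q => /(_ order_P); lia.
have [ak|ka2] := eqVneq a k.+1; last first.
  (* One vertex moves from [K_a] to [K_b]. *)
  left; apply: (step l a.-1 b.+1) => //; lia.
have [|kb] := leqP b k.+1; [by right|left].
(* [K_a] becomes one more copy of [K_kappa], and [K_b] splits into [K_(b-1)] and a single vertex. *)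
apply: (step l.+1 b.-1 1); rewrite ?mulnS //; try lia.
rewrite big_ord_recr /= mulnS; lia.
Qed.

Lemma modn_eq_small d x y : x <= y < x + d -> x = y %[mod d] -> x = y.
Proof.
move=> /andP[le_xy lt_y] /esym/eqP; rewrite eqn_mod_dvd //.
by have [|d_gt0 /dvdn_leq] := posnP (y - x); lia.
Qed.

(** The size of [P] is congruent to [m] modulo kappa, so it equals [m] if it is below [m + k.+1].
    Otherwise [P] is the smallest path-complete graph, and the lower bound on [m] is its size. *)
Lemma PK_gsize_eq n m k l a bP b (P : sgraph) :
  is_PK n m k.+1 P -> 0 < l -> 0 < bP -> k < a ->
  iso P (path_complete k.+1 l a bP) ->
  1 <= b <= k.+1 -> b = n - 1 %[mod k.+1] -> m = 'C(n - 1, 2) %[mod k.+1] ->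
  (1 / 2%:R * (n%:R * (3%:R * k.+1%:R - 1) - 2%:R * k.+1%:R ^+ 2
               - k.+1%:R + 1 - b%:R * (k.+1%:R - b%:R))
     <= m%:R :> rat)%R ->
  gsize P = m.
Proof.
move=> P_PK l_gt0 bP_gt0 ka isoP b_bnd b_mod m_mod m_ge.
have [_ order_P size_P _] := P_PK.
have [card_P eq_P] := gsize_path_complete l_gt0 bP_gt0 ka isoP.
have := PK_size_dichotomy P_PK l_gt0 bP_gt0 ka isoP; rewrite -order_P in b_mod m_mod m_ge.
have [N defN] : exists N, gorder P = N.+1 by exists (k.+1 * l + a + bP); lia.
rewrite defN subn1 /= in card_P eq_P b_mod m_mod m_ge.
case=> [lt_m|[ak bk]].
  apply/esym/(@modn_eq_small k.+1); first by rewrite size_P.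
  rewrite m_mod; move: eq_P; rewrite binS bin1; set S := (_ + bP) => eq_P.
  (* All terms except the size and the binomial coefficient are multiples of kappa. *)
  have /(congr1 (modn^~ k.+1)) : (S + k) * k.+1 + gsize P = 2 * N * k.+1 + 'C(N, 2) by lia.
  by rewrite !modnMDl.
have eq_b : b = bP.
  have eq_mod : b = bP %[mod k.+1].
    have E : N = l.+1 * k.+1 + bP by lia.
    by rewrite b_mod E modnMDl.
  have [le_b|/ltnW le_b] := leqP b bP.
    by apply: modn_eq_small eq_mod; lia.
  by apply/esym; apply: modn_eq_small (esym eq_mod); lia.
apply/eqP; rewrite eqn_leq size_P andbT -(ler_nat rat); apply: le_trans m_ge.
have lN : k.+1 * l <= N by lia.
have eq_S := sum_arith_prog lN.
have eq_C : 2 * 'C(N.+1, 2) = N.+1 * N.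
  by rewrite mulnC (bin_ffact N.+1 2) ffactnS ffactn1.
have eq_N : N = k.+1 * l + k.+1 + b by lia.
move: eq_P eq_S eq_C; rewrite -eq_b; move: (\sum_(_ < _) _) ('C(_, _)) => S C.
rewrite eq_N -muln2 => /(congr1 (fun x => x%:R : rat)%R) e1.
(* The factor kappa makes the sum [S] cancel linearly against [e1]. *)
move=> /(congr1 (fun x => (k.+1 * x)%:R : rat)%R) e2 /(congr1 (fun x => x%:R : rat)%R) e3.
by lra.
Qed.

(** * The weight inequality for distances in a kappa-connected graph *)

Section KConnected.
Variables (k : nat) (G : sgraph) (v : G).
Hypothesis Gk : kconnected k.+1 G.

Lemma dist_level_ge i : 0 < i -> 0 < tail (dist v) i -> k < level (dist v) i.
Proof.
apply: (kconnected_level Gk); first exact: dist_lipschitz.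
by apply/eqP; rewrite dist_eq0.
Qed.

Lemma sigma_gsize : k.+1 < gorder G ->
  k.+1 * sigma v + k.+1 * k + gsize G <=
  'C(gorder G, 2) + (gorder G - 1) * k.*2.+1.
Proof.
move/(weight_le (level0_dist v) dist_level_ge); rewrite -/(sigma v) -/(gorder G).
by have := gsize_far_le (@dist_lipschitz G v); lia.
Qed.

(** The bound adds [weight_le] and [gsize_far_le], so both must be equalities. *)
Lemma sigma_gsize_eq : k.+1 < gorder G ->
  k.+1 * sigma v + k.+1 * k + gsize G =
    'C(gorder G, 2) + (gorder G - 1) * k.*2.+1 ->
  tight (dist v) k /\ layered (dist v).
Proof.
move=> nk eq_w; have := gsize_far_le (@dist_lipschitz G v).
have := weight_le (level0_dist v) dist_level_ge nk.
rewrite -/(sigma v) -/(gorder G) => le1 le2; split.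
  apply: (weight_eq_tight (level0_dist v) dist_level_ge nk).
  by rewrite -/(sigma v) -/(gorder G); lia.
by apply: gsize_far_layered; [exact: dist_lipschitz|lia].
Qed.
End KConnected.

(** * Remoteness and the comparison with PK *)

Section Remoteness.
Variable G : sgraph.
Hypothesis G_gt1 : 1 < gorder G.

Lemma avg_sigma_le (H : sgraph) (v : G) (w : H) : gorder H = gorder G ->
  (avg_sigma v <= avg_sigma w)%R = (sigma v <= sigma w).
Proof.
move=> eq_o; rewrite /avg_sigma eq_o ler_pM2r ?ler_nat // invr_gt0 subr_gt0.
by rewrite ltr1n.
Qed.

Lemma remoteness_arg : exists v : G, remoteness G = avg_sigma v.
Proof.
have /card_gt0P[v0 _] : 0 < gorder G by apply: ltnW.
have avg_ge0 (v : G) : true -> (0 <= avg_sigma v)%R.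
  by rewrite /avg_sigma divr_ge0 ?ler0n // subr_ge0 ler1n ltnW.
by have [v _ E] := @eq_bigmax _ _ _ 0%R v0 xpredT _ isT avg_ge0; exists v.
Qed.
End Remoteness.

Theorem mainTheorem2 (kappa n m : nat) (G P : sgraph)
    (kappa_gt0 : 0 < kappa)
    (G_kconn : kconnected kappa G)
    (G_order : gorder G = n)
    (G_size : m <= gsize G)
    (m_le : m <= 'C(n - 1, 2))
    (P_PK : is_PK n m kappa P) :
  (remoteness G <= remoteness P)%R /\
  (forall b : nat,
     1 <= b <= kappa ->
     b = n - 1 %[mod kappa] ->
     m = 'C(n - 1, 2) %[mod kappa] ->
     (1 / 2%:R * (n%:R * (3%:R * kappa%:R - 1) - 2%:R * kappa%:R ^+ 2
                  - kappa%:R + 1 - b%:R * (kappa%:R - b%:R))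
        <= m%:R :> rat)%R ->
     remoteness G = remoteness P ->
     iso G P).
Proof.
case: kappa kappa_gt0 G_kconn P_PK => // k _ Gk P_PK.
have [[l [a [bP [l_gt0 a_gt0 bP_gt0 ka isoP]]]] order_P size_P _] := P_PK.
have [card_P eq_P] := gsize_path_complete l_gt0 bP_gt0 ka isoP.
have dich := PK_size_dichotomy P_PK l_gt0 bP_gt0 ka isoP.
have [g lg g_level] := path_complete_layers isoP.
have kl : k.+1 <= k.+1 * l by rewrite leq_pmulr.
have sum_g := pc_sum l_gt0 bP_gt0 ka g_level.
rewrite -/(gorder P) in sum_g; rewrite -sum_g in eq_P.
(* The vertex of the initial [K_1]. *)
have [v0 gv0] : exists v0, g v0 = 0.
  by apply/level_gt0; rewrite (pc_level0 g_level).
have sigma_v0 : \sum_x g x <= sigma v0.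
  apply: leq_sum => x _; apply: lipschitz_dist => //.
    exact: layered_lipschitz.
  apply: leq_trans (pc_le l_gt0 bP_gt0 ka g_level x) _.
  by rewrite card_P; nia.
have nk : k.+1 < gorder G by rewrite G_order -order_P card_P; lia.
have eqGP : gorder G = gorder P by rewrite order_P.
have G_gt1 : 1 < gorder G by lia.
have sigma_le (v : G) : sigma v <= \sum_x g x.
  have := sigma_gsize v Gk nk.
  case: dich => [lt_m|[ak bk]] le_w.
    (* The size of [P] is less than the size of [G] plus kappa, so the weight bound keeps [sigma v]
       below the sum of [g] plus one. *)
    rewrite -ltnS -(ltn_pmul2l (ltn0Sn k)) mulnS; move: le_w.
    by rewrite eqGP; lia.
  (* For the smallest path-complete graph the tails of [g] attain the bound of [tail_le], so the
     sums are compared tail by tail. *)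
  pose B := maxn (gorder G) l.+2.
  have dB x : dist v x <= B by rewrite leq_max dist_le_order.
  have gB x : g x <= B.
    by rewrite leq_max (pc_le l_gt0 bP_gt0 ka g_level) orbT.
  rewrite /sigma (sum_tail dB) (sum_tail gB); apply: leq_sum => j _.
  rewrite (pc_tail_max l_gt0 bP_gt0 ka g_level) // -/(gorder P) -eqGP.
  exact: tail_le (level0_dist v) (dist_level_ge Gk) _.
have avg_v0 : (avg_sigma v0 <= remoteness P)%R by apply: le_bigmax.
have [v rem_v] := remoteness_arg G_gt1.
split=> [|b b_bnd b_mod m_mod m_ge rem_eq].
  rewrite rem_v; apply: le_trans avg_v0; rewrite avg_sigma_le //.
  exact: leq_trans (sigma_le v) sigma_v0.
have sigma_v : sigma v = \sum_x g x.
  apply/eqP; rewrite eqn_leq sigma_le; apply: leq_trans sigma_v0 _.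
  rewrite -(@avg_sigma_le P _ G v0 v) -?eqGP //.
  by rewrite -rem_v rem_eq.
have size_m := PK_gsize_eq P_PK l_gt0 bP_gt0 ka isoP b_bnd b_mod m_mod m_ge.
(* [G] has at least [m] edges, which is the size of [P], and the distance sums agree; hence the
   weight inequality for [G] is an equality. *)
have eq_w : k.+1 * sigma v + k.+1 * k + gsize G =
    'C(gorder G, 2) + (gorder G - 1) * k.*2.+1.
  by have := sigma_gsize v Gk nk; rewrite eqGP sigma_v; lia.
have [tf lf] := sigma_gsize_eq Gk nk eq_w.
have tail_eq j : tail (dist v) j = tail g j.
  have f_le := tail_le (level0_dist v) (dist_level_ge Gk).
  have g_le := tail_le (pc_level0 g_level) (pc_level_ge l_gt0 bP_gt0 ka g_level).
  have tg := pc_tight l_gt0 bP_gt0 ka g_level.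
  have eqc : #|G| = #|P| := eqGP.
  apply/eqP; rewrite eqn_leq (tight_tail_le eqc sigma_v _ f_le tf tg) ?eqc //.
  by rewrite (tight_tail_le (esym eqc) (esym sigma_v) _ g_le tg tf) -?eqc.
(* Beyond level 0, level sizes are differences of consecutive tails. *)
apply: layered_iso lf lg _ => -[|i].
  by rewrite level0_dist (pc_level0 g_level).
by have := tail_recl (dist v) i; rewrite !tail_eq (tail_recl g); lia.
Qed.
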